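(* Let $p$ be an odd prime, $q\in\mathbb{C}_p$ with $|q-1|_p<1$, $h\in\mathbb{Z}$ and $\zeta\in T_p$. Let $s\in\mathbb{N}$ with $s\ge2$ and let $n_1,\dots,n_s,k\in\mathbb{Z}_+$ with $n_1+\cdots+n_s>sk$. Then $$\int_{\mathbb{Z}_p}B_{k,n_1}(x,q)\cdots B_{k,n_s}(x,q)\,q^{(h-1)x}\zeta^x\,d\mu_{-q}(x)=\begin{cases}q^{h+1}\zeta E^{(h)}_{n_1+\cdots+n_s,q^{-1},\zeta^{-1}}+[2]_q, & k=0,\\[1mm] q^{h+1}\zeta\binom{n_1}{k}\cdots\binom{n_s}{k}\sum_{l=0}^{sk}\binom{sk}{l}(-1)^{l+sk}E^{(h)}_{n_1+\cdots+n_s-l,q^{-1},\zeta^{-1}}, & k>0.\end{cases}$$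
   Context: $\mathbb{Z}_p$, $\mathbb{C}_p$ denote the $p$-adic integers and the completion of the algebraic closure of $\mathbb{Q}_p$; $\mathbb{Z}_+=\{0,1,2,\dots\}$. $T_p=\bigcup_{n\ge1}\{\zeta\in\mathbb{C}_p:\zeta^{p^n}=1\}$; for $\zeta\in T_p$ and $y\in\mathbb{Z}_p$, $\zeta^y$ is defined by continuity. For $Q\in\mathbb{C}_p$ with $|Q-1|_p<1$ (applied to $Q=q$ and $Q=q^{-1}$), $[x]_Q=\frac{1-Q^x}{1-Q}$ (so $[2]_q=1+q$), and for uniformly differentiable $f:\mathbb{Z}_p\to\mathbb{C}_p$, $\int_{\mathbb{Z}_p}f(x)\,d\mu_{-Q}(x)=\lim_{N\to\infty}\frac{1+Q}{1+Q^{p^N}}\sum_{x=0}^{p^N-1}f(x)(-Q)^x$. For $\xi\in T_p$ and $n\in\mathbb{Z}_+$, $E^{(h)}_{n,Q,\xi}(x)=\int_{\mathbb{Z}_p}[x+y]_Q^n\xi^y Q^{(h-1)y}\,d\mu_{-Q}(y)$ and $E^{(h)}_{n,Q,\xi}=E^{(h)}_{n,Q,\xi}(0)$. The $q$-Bernstein polynomials are $B_{k,n}(x,q)=\binom{n}{k}[x]_q^k[1-x]_{q^{-1}}^{n-k}$ for $x\in\mathbb{Z}_p$ and $n,k\in\mathbb{Z}_+$. *)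

(* Defs.v *)
From HB Require Import structures.
From mathcomp Require Import all_boot all_order all_algebra.
From mathcomp Require Import all_classical all_reals topology.

Set Implicit Arguments.
Unset Strict Implicit.
Unset Printing Implicit Defensive.

Import Order.TTheory GRing.Theory Num.Theory.

Local Open Scope classical_set_scope.
Local Open Scope ring_scope.

(* Complete extensions of Q_p: fields that are complete for an ultrametric
   multiplicative absolute value [pabs], with values in R, normalised by
   |p| = 1/p. *)
HB.mixin Record isPadicValued (p : nat) (R : realType) K
    & GRing.Field K & Metric R K := {
  pabs : K -> R;
  mdist_pabs : forall x y : K, mdist x y = pabs (x - y);
  pabsM : forall x y : K, pabs (x * y) = pabs x * pabs y;
  pabsD_max : forall x y : K, pabs (x + y) <= Num.max (pabs x) (pabs y);
  pabs_prime : pabs p%:R = p%:R^-1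
}.

#[short(type="padicValuedFieldType")]
HB.structure Definition PadicValuedField (p : nat) (R : realType) :=
  {K of GRing.Field K & Complete K & Metric R K & isPadicValued p R K}.

(* As K is complete, the completion Q_p of Q for the p-adic absolute value is
   the closure of Q in K. *)
Definition Qp (p : nat) (R : realType) (K : padicValuedFieldType p R) : set K :=
  closure (range (ratr : rat -> K)).

Definition Qpbar (p : nat) (R : realType) (K : padicValuedFieldType p R) :
    set K :=
  [set x | exists P : {poly K},
     [/\ P != 0, (forall i, Qp P`_i) & root P x]].

(* C_p is the completion of an algebraic closure of Q_p: the elements of K
   algebraic over Q_p form an algebraic closure of Q_p, and they are dense in
   the complete field K. This determines K up to isometric isomorphism. *)
HB.mixin Record isPadicComplex (p : nat) (R : realType) K
    & PadicValuedField p R K := {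
  Qpbar_closed : forall P : {poly K},
    (forall i, Qpbar P`_i) -> (1 < size P)%N ->
    exists2 x : K, Qpbar x & root P x;
  Qpbar_dense : dense (@Qpbar p R K)
}.

#[short(type="padicComplexType")]
HB.structure Definition PadicComplex (p : nat) (R : realType) :=
  {K of PadicValuedField p R K & isPadicComplex p R K}.

Section PadicIntegers.
Context {p : nat} {R : realType}.

Definition padicInt_pred (K : padicValuedFieldType p R) : {pred K} :=
  fun x => x \in closure (range (intr : int -> K)).
Arguments padicInt_pred K : clear implicits.

Section Theory.
Variable K : padicValuedFieldType p R.
Implicit Types x y : K.
Local Notation pabs := (@pabs p R K).

Lemma pabs_ge0 x : 0 <= pabs x.
Proof. by rewrite -[x]subr0 -mdist_pabs mdist_ge0. Qed.

Lemma pabs0 : pabs 0 = 0.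
Proof. by rewrite -(subrr (0 : K)) -mdist_pabs mdistxx. Qed.

Lemma pabs1 : pabs 1 = 1.
Proof.
have n0 : pabs 1 != 0.
  apply/eqP => h; have /mdist_positivity/eqP : mdist (1 : K) 0 = 0.
    by rewrite mdist_pabs subr0.
  by rewrite oner_eq0.
by apply: (mulfI n0); rewrite -pabsM !mulr1.
Qed.

Lemma pabsN x : pabs (- x) = pabs x.
Proof. by rewrite -[- x]sub0r -mdist_pabs metric_sym mdist_pabs subr0. Qed.

Lemma pabs_int (n : int) : pabs n%:~R <= 1.
Proof.
have h (m : nat) : pabs m%:R <= 1.
  elim: m => [|m IH]; first by rewrite pabs0.
  by rewrite -natr1 (le_trans (pabsD_max _ _))// ge_max IH pabs1 /=.
by case: n => n; rewrite ?NegzE ?mulrNz ?pabsN; exact: h.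
Qed.

Lemma padicInt_predP x :
  reflect (forall e, 0 < e -> exists n : int, pabs (x - n%:~R) < e)
          (x \in padicInt_pred K).
Proof.
apply: (iffP idP) => [/set_mem h e e0|h].
  have [_ [[n _ <-]]] := h _ (nbhsx_ballx x e e0).
  by rewrite ballEmdist /= mdist_pabs; exists n.
apply/mem_set => B /nbhs_ballP[e /= e0 eB].
have [n hn] := h e e0; exists n%:~R; split; first by exists n.
by apply: eB; rewrite ballEmdist /= mdist_pabs.
Qed.

Lemma padicInt_pabs_le1 x : x \in padicInt_pred K -> pabs x <= 1.
Proof.
move=> /padicInt_predP/(_ 1 ltr01)[n hn]; rewrite -[x](subrK n%:~R).
by rewrite (le_trans (pabsD_max _ _))// ge_max (ltW hn) pabs_int.
Qed.

Lemma padicInt_subring : GRing.subring_closed (padicInt_pred K).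
Proof.
split=> [|x y /padicInt_predP hx /padicInt_predP hy|x y hx' /padicInt_predP hy].
- by apply/padicInt_predP => e e0; exists 1; rewrite subrr pabs0.
- apply/padicInt_predP => e e0.
  have [[m hm] [n hn]] := (hx _ e0, hy _ e0); exists (m - n).
  have -> : x - y - (m - n)%:~R = (x - m%:~R) + - (y - n%:~R).
    by rewrite intrB !opprB addrACA [- y + _]addrC -addrACA.
  by rewrite (le_lt_trans (pabsD_max _ _))// gt_max hm pabsN.
- have /padicInt_predP hx := hx'; apply/padicInt_predP => e e0.
  have [[m hm] [n hn]] := (hx _ e0, hy _ e0); exists (m * n).
  have -> : x * y - (m * n)%:~R = x * (y - n%:~R) + (x - m%:~R) * n%:~R.
    by rewrite intrM mulrBr mulrBl addrA subrK.
  rewrite (le_lt_trans (pabsD_max _ _))// gt_max !pabsM.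
  rewrite (le_lt_trans (ler_piMl _ (padicInt_pabs_le1 hx')))//= ?pabs_ge0//.
  by rewrite (le_lt_trans (ler_piMr _ (pabs_int n)))// pabs_ge0.
Qed.

HB.instance Definition _ :=
  GRing.isSubringClosed.Build K (padicInt_pred K) padicInt_subring.

End Theory.

(* The p-adic integers: the closure of Z in K, as a subring type of K. *)
Record padicInt (K : padicValuedFieldType p R) :=
  PadicInt { padicInt_val : K; _ : padicInt_val \in padicInt_pred K }.

HB.instance Definition _ (K : padicValuedFieldType p R) :=
  [isSub for @padicInt_val K].
HB.instance Definition _ (K : padicValuedFieldType p R) :=
  [Choice of padicInt K by <:].
HB.instance Definition _ (K : padicValuedFieldType p R) :=
  [SubChoice_isSubComNzRing of padicInt K by <:].

End PadicIntegers.

Arguments padicInt_pred {p R} K.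
Arguments padicInt {p R} K.

Section QBernstein.
Context {p : nat} {R : realType} {K : padicComplexType p R}.

(* The filter on nat of the natural numbers tending p-adically to x. *)
Definition nat_near (x : padicInt K) : set_system nat :=
  filter_from (nbhs (padicInt_val x : K)) (fun U => [set n : nat | U n%:R]).

(* Q^x: the continuous extension to Z_p of n |-> Q^n on nat. It exists when
   |Q - 1| < 1, in particular for p-power roots of unity. *)
Definition zpow (Q : K) (x : padicInt K) : K := lim (Q ^+ n @[n --> nat_near x]).

Definition Tp : set K :=
  [set zeta | exists2 n : nat, (1 <= n)%N & zeta ^+ (p ^ n) = 1].

(* [x]_Q, with the usual convention [x]_1 = lim_(Q -> 1) [x]_Q = x. *)
Definition qnum (Q : K) (x : padicInt K) : K :=
  if Q == 1 then padicInt_val x else (1 - zpow Q x) / (1 - Q).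

(* The integral of f over Z_p with respect to mu_(-Q). *)
Definition fermionic_integral (Q : K) (f : padicInt K -> K) : K :=
  lim ((1 + Q) / (1 + Q ^+ (p ^ N)%N) *
         (\sum_(x < p ^ N) f x%:R * (- Q) ^+ x) @[N --> \oo]).

Definition qEuler_poly (h : int) (n : nat) (Q xi : K) (x : padicInt K) : K :=
  fermionic_integral Q
    (fun y => qnum Q (x + y) ^+ n * zpow xi y * zpow Q ((h - 1)%:~R * y)).

Definition qEuler (h : int) (n : nat) (Q xi : K) : K := qEuler_poly h n Q xi 0.

(* For n < k the binomial coefficient vanishes, so the truncation of n - k is
   harmless. *)
Definition qBernstein (k n : nat) (x : padicInt K) (q : K) : K :=
  'C(n, k)%:R * qnum q x ^+ k * qnum q^-1 (1 - x) ^+ (n - k).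

End QBernstein.

(* Main.v *)
Require Import Defs.
From mathcomp Require Import all_boot all_order all_algebra.
From mathcomp Require Import all_classical all_reals topology.
From mathcomp Require Import lra ring.

Import Order.TTheory GRing.Theory Num.Theory.
Local Open Scope classical_set_scope.
Local Open Scope ring_scope.

(* Since q^(p^N) tends to 1, the integral of f against mu_(-q) is (1 + q) / 2
   times the limit of the alternating sums of x |-> f(x) q^x over x < p^N. For
   G uniformly continuous on Z, that limit L(G) exists, is unchanged by
   y |-> -1 - y because p^N - 1 is even, and satisfies
   L(G(. + 1)) + L(G) = 2 G(0). Hence L(G(1 - .)) = L(G) + 2 (G(1) - G(0)).
   With G(y) = [y]_Q^m zeta^(-y) Q^(h y) and Q = 1/q this gives, for m > 0,
     integral of [1 - x]_Q^m q^((h-1)x) zeta^x = q^(h+1) zeta E_m + [2]_q.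
   As [x]_q = 1 - [1 - x]_Q, the product of Bernstein polynomials expands
   binomially in powers of [1 - x]_Q with positive exponents, and the terms
   [2]_q cancel when k > 0, their coefficients adding up to (1 - 1)^(s k). *)

(** A Bernoulli inequality written without division, so that [c = 0] is included:
    [c^n (1 + n (1 - c)) <= 1], and the bracket is unbounded. *)
Lemma exists_expr_lt (R : archiRealFieldType) (c e : R) :
  0 <= c < 1 -> 0 < e -> exists n, c ^+ n < e.
Proof.
move=> /andP[c0 c1] e0.
have bern n : c ^+ n * (1 + n%:R * (1 - c)) <= 1.
  elim: n => [|n IH]; first by rewrite mul0r addr0 mulr1.
  apply: le_trans IH; rewrite exprSr -mulrA ler_wpM2l ?exprn_ge0// -natr1.
  have : 0 <= (n%:R + 1) * (1 - c) ^+ 2 by rewrite mulr_ge0 ?sqr_ge0 ?addr_ge0.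
  lra.
have ec0 : 0 < e * (1 - c) by rewrite mulr_gt0// subr_gt0.
exists (Num.bound (e * (1 - c))^-1).
have := archi_boundP (ltW (eqbRL (invr_gt0 _) ec0)).
set n := Num.bound _; rewrite -div1r ltr_pdivrMr// => hn.
have := bern n; have : 0 <= c ^+ n by rewrite exprn_ge0.
nra.
Qed.

(** * Ultrametric estimates, p-adic powers and uniformly continuous functions on Z *)

Section PadicValued.
Context {p : nat} {R : realType} {K : padicValuedFieldType p R}.
Implicit Types (x Q : K) (G H : int -> K).

Lemma pabsX x n : pabs (x ^+ n) = pabs x ^+ n.
Proof. by elim: n => [|n IH]; rewrite ?pabs1// !exprS pabsM IH. Qed.

Lemma pabs_eq0 x : (pabs x == 0) = (x == 0).
Proof.
apply/eqP/eqP => [h|->]; last exact: pabs0.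
by apply: (@mdist_positivity R K); rewrite mdist_pabs subr0.
Qed.

Lemma pabsV x : pabs x^-1 = (pabs x)^-1.
Proof.
have [->|x0] := eqVneq x 0; first by rewrite invr0 pabs0 invr0.
have px0 : pabs x != 0 by rewrite pabs_eq0.
by apply: (mulIf px0); rewrite -pabsM !mulVf ?pabs1.
Qed.

Lemma pabsC x y : pabs (x - y) = pabs (y - x).
Proof. by rewrite -pabsN opprB. Qed.

Lemma pabsD_lt x y e : pabs x < e -> pabs y < e -> pabs (x + y) < e.
Proof. by move=> hx hy; rewrite (le_lt_trans (pabsD_max _ _))// gt_max hx. Qed.

Lemma pabsB_lt x y e : pabs x < e -> pabs y < e -> pabs (x - y) < e.
Proof. by move=> hx hy; rewrite pabsD_lt// pabsN. Qed.

Lemma pabs_sum_lt (I : Type) (r : seq I) (P : pred I) (F : I -> K) e :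
  0 < e -> (forall i, P i -> pabs (F i) < e) ->
  pabs (\sum_(i <- r | P i) F i) < e.
Proof.
move=> e0; apply: (big_ind (fun x => pabs x < e)) => [|x y].
  by rewrite pabs0.
exact: pabsD_lt.
Qed.

Lemma pabs_sum_le (I : Type) (r : seq I) (P : pred I) (F : I -> K) c :
  0 <= c -> (forall i, P i -> pabs (F i) <= c) ->
  pabs (\sum_(i <- r | P i) F i) <= c.
Proof.
move=> c0; apply: (big_ind (fun x => pabs x <= c)) => [|x y hx hy].
  by rewrite pabs0.
by rewrite (le_trans (pabsD_max _ _))// ge_max hx.
Qed.

(** If [|x| < 1], then [1 = x - (x - 1)] would have absolute value below 1. *)
Lemma pabs_near1 x : pabs (x - 1) < 1 -> pabs x = 1.
Proof.
move=> h; apply/eqP; rewrite eq_le -{1}[x](subrK 1).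
rewrite (le_trans (pabsD_max _ _)) ?ge_max ?(ltW h) ?pabs1//=.
rewrite leNgt; apply/negP => x1; have := pabsB_lt _ _ _ x1 h.
by rewrite opprB addrC subrK pabs1 ltxx.
Qed.

Lemma pabs_subV1 x : pabs x = 1 -> pabs (x^-1 - 1) = pabs (x - 1).
Proof.
move=> x1; have x0 : x != 0 by rewrite -pabs_eq0 x1 oner_eq0.
have -> : x^-1 - 1 = x^-1 * (1 - x) by rewrite mulrBr mulr1 mulVf.
by rewrite pabsM pabsV x1 invr1 mul1r pabsC.
Qed.

Lemma pabs_subX1 x n : pabs x <= 1 -> pabs (x ^+ n - 1) <= pabs (x - 1).
Proof.
move=> x1; rewrite subrX1 pabsM ler_piMr ?pabs_ge0// pabs_sum_le// => i _.
by rewrite pabsX exprn_ile1// pabs_ge0.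
Qed.

Hypothesis p_prime : prime p.

Let pV_gt0 : 0 < p%:R^-1 :> R.
Proof. by rewrite invr_gt0 ltr0n prime_gt0. Qed.

Let pV_lt1 : p%:R^-1 < 1 :> R.
Proof. by rewrite invf_lt1 ?ltr0n ?ltr1n ?prime_gt1// prime_gt0. Qed.

(** If [|a| < 1], both terms of a Bezout relation [u a + v p = 1] would have absolute value below
    1. *)
Lemma pabs_int_coprime (a : int) : ~~ (p%:Z %| a)%Z -> pabs (a%:~R : K) = 1.
Proof.
move=> pa; apply/eqP; rewrite eq_le pabs_int leNgt; apply/negP => a1.
have [u [v]] := Bezoutz a p%:Z.
have -> : gcdz a p%:Z = 1.
  apply/eqP; rewrite /gcdz eqz_nat /= gcdnC -/(coprime _ _) prime_coprime//.
move=> /(congr1 (fun z : int => z%:~R : K)); rewrite intrD !intrM => uv.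
suff : pabs (1 : K) < 1 by rewrite pabs1 ltxx.
rewrite -[X in pabs X]uv pabsD_lt// pabsM.
  by rewrite (le_lt_trans (ler_piMl _ (pabs_int _ _)))// pabs_ge0.
by rewrite (le_lt_trans (ler_piMl _ (pabs_int _ _)))// ?pabs_ge0// pabs_prime.
Qed.

(** Turns closeness in [K] into a congruence. In the induction, a quotient prime to [p] would have
    absolute value 1, leaving [|a|] too large. *)
Lemma pabs_int_dvd (a : int) (n : nat) : pabs (a%:~R : K) <= p%:R^-1 ^+ n ->
  exists b : int, a = p%:Z ^+ n * b.
Proof.
elim: n a => [|n IH] a ha; first by exists a; rewrite mul1r.
have [|b ab] := IH a.
  by rewrite (le_trans ha)// exprS ler_piMl ?exprn_ge0 ?ltW.
have [/dvdzP[c bc]|/pabs_int_coprime b1] := boolP (p%:Z %| b)%Z.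
  by exists c; rewrite ab bc exprSr -mulrA [p%:Z * c]mulrC.
move: ha; rewrite ab intrM pabsM b1 mulr1 rmorphXn /= pabsX pabs_prime leNgt.
by rewrite exprS gtr_pMl ?exprn_gt0// pV_lt1.
Qed.

Lemma pabs_pX (n : nat) : pabs (p%:R ^+ n : K) = p%:R^-1 ^+ n.
Proof. by rewrite pabsX pabs_prime. Qed.

(** [Q^p - 1] is [Q - 1] times the sum of the [Q^i], which differs from [p] by terms [Q^i - 1], none
    larger than [Q - 1]. *)
Lemma pabs_subXp1 Q : pabs (Q - 1) < 1 ->
  pabs (Q ^+ p - 1) <= Num.max p%:R^-1 (pabs (Q - 1)) * pabs (Q - 1).
Proof.
move=> h; rewrite subrX1 pabsM mulrC ler_wpM2r ?pabs_ge0//.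
have -> : \sum_(i < p) Q ^+ i = p%:R + \sum_(i < p) (Q ^+ i - 1).
  by rewrite big_split /= sumrN sumr_const card_ord addrCA subrr addr0.
rewrite (le_trans (pabsD_max _ _))// ge_max pabs_prime le_max lexx /=.
rewrite pabs_sum_le// ?le_max ?pabs_ge0 ?orbT// => i _.
by rewrite le_max pabs_subX1 ?orbT// pabs_near1.
Qed.

(* The bases [Q] for which [n |-> Q ^+ n] extends continuously to Z_p with
   values of absolute value 1. *)
Definition zpow_base Q := pabs Q = 1 /\
  forall e : R, 0 < e -> exists N0, forall N, (N0 <= N)%N ->
    pabs (Q ^+ (p ^ N)%N - 1) < e.

(** One exponent suffices: further powers never increase the distance to 1. *)
Lemma zpow_baseP Q : pabs Q = 1 ->
  (forall e, 0 < e -> exists N, pabs (Q ^+ (p ^ N)%N - 1) < e) -> zpow_base Q.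
Proof.
move=> Q1 h; split=> // e e0; have [N0 hN0] := h e e0.
exists N0 => N le; apply: le_lt_trans hN0; rewrite -(subnKC le) expnD exprM.
by rewrite pabs_subX1// pabsX Q1 expr1n.
Qed.

(** Each p-th power shrinks the distance to 1 by the fixed factor [max (1/p, |Q - 1|) < 1]. *)
Lemma zpow_base_near1 Q : pabs (Q - 1) < 1 -> zpow_base Q.
Proof.
move=> h; apply: zpow_baseP; first exact: pabs_near1.
set c := Num.max p%:R^-1 (pabs (Q - 1)) => e e0.
have c01 : 0 <= c < 1 by rewrite /c le_max (ltW pV_gt0)/= gt_max pV_lt1 h.
have /andP[c0 c1] := c01.
have [N hN] := exists_expr_lt R c e c01 e0; exists N; apply: le_lt_trans hN.
suff : pabs (Q ^+ (p ^ N) - 1) <= c ^+ N * pabs (Q - 1).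
  by move/le_trans; apply; rewrite ler_piMr ?exprn_ge0 ?(ltW h).
elim: N => [|N IH]; first by rewrite mul1r.
rewrite expnSr exprM; set Q' := Q ^+ (p ^ N).
have Q'Q : pabs (Q' - 1) <= pabs (Q - 1) by rewrite pabs_subX1// pabs_near1.
rewrite (le_trans (pabs_subXp1 _ (le_lt_trans Q'Q h)))// exprS -mulrA.
apply: ler_pM; rewrite ?pabs_ge0//; first by rewrite le_max pabs_ge0 orbT.
by rewrite ge_max /c !le_max lexx Q'Q orbT.
Qed.

Lemma zpow_baseV Q : zpow_base Q -> zpow_base Q^-1.
Proof.
move=> [Q1 h]; split; first by rewrite pabsV Q1 invr1.
move=> e /h[N0 hN0]; exists N0 => N /hN0.
by rewrite exprVn pabs_subV1// pabsX Q1 expr1n.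
Qed.

Lemma zpow_base_neq0 Q : zpow_base Q -> Q != 0.
Proof. by move=> [Q1 _]; rewrite -pabs_eq0 Q1 oner_eq0. Qed.

Lemma pabs_exprz1 Q (a : int) : pabs Q = 1 -> pabs (Q ^ a) = 1.
Proof.
move=> Q1; case: a => n; rewrite ?NegzE -?exprnP -?exprnN ?pabsV pabsX Q1 expr1n//.
by rewrite invr1.
Qed.

Lemma pabs_exprz_sub1 Q (a : int) : pabs Q = 1 ->
  pabs (Q ^ a - 1) <= pabs (Q - 1).
Proof.
move=> Q1; have Q0 : Q != 0 by rewrite -pabs_eq0 Q1 oner_eq0.
case: a => n; first by rewrite -exprnP pabs_subX1 ?Q1.
by rewrite NegzE -exprnN pabs_subV1 ?pabsX ?Q1 ?expr1n// pabs_subX1 ?Q1.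
Qed.

(* Bounded and uniformly continuous on Z for the p-adic topology. *)
Definition padic_bucont G :=
  (exists C, forall y, pabs (G y) <= C) /\
  forall e : R, 0 < e ->
    exists N, forall y a : int, pabs (G (y + p%:Z ^+ N * a) - G y) < e.

Lemma bucont_cst (c : K) : padic_bucont (fun=> c).
Proof.
split; first by exists (pabs c).
by move=> e e0; exists 0%N => y a; rewrite subrr pabs0.
Qed.

Lemma bucont_le G e : padic_bucont G -> 0 < e ->
  exists N0, forall N, (N0 <= N)%N ->
    forall y a : int, pabs (G (y + p%:Z ^+ N * a) - G y) < e.
Proof.
move=> [_ h] /h[N0 hN0]; exists N0 => N le y a.
by rewrite -(subnKC le) exprD -mulrA.
Qed.

Lemma bucontB G H : padic_bucont G -> padic_bucont H ->
  padic_bucont (fun y => G y - H y).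
Proof.
move=> cG cH; have [[C hC] _] := cG; have [[D hD] _] := cH; split.
  exists (Num.max C D) => y; rewrite (le_trans (pabsD_max _ _))// pabsN.
  by rewrite ge_max !le_max hC hD orbT.
move=> e e0; have [[N hN] [M hM]] := (bucont_le _ _ cG e0, bucont_le _ _ cH e0).
exists (maxn N M) => y a; set z := y + _.
have -> : G z - H z - (G y - H y) = (G z - G y) - (H z - H y) by ring.
by rewrite pabsB_lt ?hN ?hM ?leq_maxl ?leq_maxr.
Qed.

Lemma bucontM G H : padic_bucont G -> padic_bucont H ->
  padic_bucont (fun y => G y * H y).
Proof.
move=> cG cH; have [[C hC] _] := cG; have [[D hD] _] := cH.
have C0 : 0 <= C := le_trans (pabs_ge0 _) (hC 0).
have D0 : 0 <= D := le_trans (pabs_ge0 _) (hD 0).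
(* The tolerance [e / (C + D + 1)] serves both factors; the [+ 1] keeps the denominator positive
   when both bounds vanish. *)
have CD : 0 < C + D + 1 by rewrite ltr_pwDr// addr_ge0.
split.
  by exists (C * D) => y; rewrite pabsM ler_pM ?pabs_ge0.
move=> e e0; have d0 : 0 < e / (C + D + 1) by rewrite divr_gt0.
have [[N hN] [M hM]] := (bucont_le _ _ cG d0, bucont_le _ _ cH d0).
exists (maxn N M) => y a; set z := y + _.
have -> : G z * H z - G y * H y = G z * (H z - H y) + (G z - G y) * H y by ring.
rewrite pabsD_lt// pabsM.
  apply: le_lt_trans (ler_wpM2r (pabs_ge0 _) (hC z)) _.
  have := hM _ (leq_maxr N M) y a; rewrite -/z (ltr_pdivlMr _ _ CD) => h.
  by have := pabs_ge0 (H z - H y); nra.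
apply: le_lt_trans (ler_wpM2l (pabs_ge0 _) (hD y)) _.
have := hN _ (leq_maxl N M) y a; rewrite -/z (ltr_pdivlMr _ _ CD) => h.
by have := pabs_ge0 (G z - G y); nra.
Qed.

Lemma bucontX G n : padic_bucont G -> padic_bucont (fun y => G y ^+ n).
Proof.
move=> cG; elim: n => [|n IH]; first exact: bucont_cst.
by under eq_fun do rewrite exprS; exact: bucontM.
Qed.

Lemma bucont_affine G (c d : int) :
  padic_bucont G -> padic_bucont (fun y => G (c * y + d)).
Proof.
move=> [[C hC] h]; split; first by exists C.
move=> e /h[N hN]; exists N => y a.
by rewrite mulrDr mulrCA addrAC.
Qed.

(** [Q^(y + p^N a) - Q^y = Q^y ((Q^(p^N))^a - 1)] is bounded by [|Q^(p^N) - 1|], uniformly in [y]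
    and [a]. *)
Lemma bucont_exprz Q : zpow_base Q -> padic_bucont (fun y => Q ^ y).
Proof.
move=> bQ; have [Q1 h] := bQ; split.
  by exists 1 => y; rewrite pabs_exprz1.
move=> e /h[N hN]; exists N => y a; have Q0 := zpow_base_neq0 _ bQ.
rewrite expfzDr// -[X in _ - X]mulr1 -mulrBr pabsM pabs_exprz1// mul1r.
rewrite -exprz_exp (le_lt_trans (pabs_exprz_sub1 _ _ _)) ?pabs_exprz1//.
by rewrite -[p%:Z]natz -natrX natz hN.
Qed.

Lemma bucont_intr : padic_bucont (fun y => y%:~R).
Proof.
split; first by exists 1 => y; rewrite pabs_int.
move=> e e0; have [|N hN] := exists_expr_lt R p%:R^-1 e _ e0.
  by rewrite pV_lt1 ltW.
exists N => y a; rewrite intrD addrC addKr intrM pabsM rmorphXn /= pabs_pX.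
by rewrite (le_lt_trans _ hN)// ler_piMr ?pabs_int// exprn_ge0// ltW.
Qed.

End PadicValued.

(** * Alternating sums over [x < p^N] and their limits *)

Section AlternatingLimit.
Context {p : nat} {R : realType} {K : padicValuedFieldType p R}.
Implicit Types (x Q l : K) (G H : int -> K).
Hypotheses (p_prime : prime p) (p_odd : odd p).

Definition alt_sum G (n : nat) : K := \sum_(x < n) (-1) ^+ x * G x.

(** This is the fermionic integral at [q = 1], where the normalising quotient is 1. Taking [G] on Z
    allows negative arguments, as in [G (1 - y)]. *)
Definition alt_lim G l := forall e : R, 0 < e ->
  exists N0, forall N, (N0 <= N)%N -> pabs (alt_sum G (p ^ N) - l) < e.

Lemma odd_pX N : odd (p ^ N).
Proof. by rewrite oddX p_odd orbT. Qed.

Lemma pabs_sign_mul n x : pabs ((-1) ^+ n * x) = pabs x.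
Proof. by rewrite pabsM pabsX pabsN pabs1 expr1n mul1r. Qed.

Lemma alt_sum_lt G H n e : 0 < e -> (forall x : nat, pabs (G x - H x) < e) ->
  pabs (alt_sum G n - alt_sum H n) < e.
Proof.
move=> e0 h; rewrite /alt_sum -sumrB pabs_sum_lt// => i _.
by rewrite -mulrBr pabs_sign_mul.
Qed.

Lemma alt_sum_addn G m n :
  alt_sum G (m + n) =
    alt_sum G m + (-1) ^+ m * alt_sum (fun y => G (y + m%:Z)) n.
Proof.
rewrite /alt_sum big_split_ord /=; congr (_ + _).
rewrite mulr_sumr; apply: eq_bigr => i _ /=.
by rewrite mulrA -exprD PoszD addrC.
Qed.

(** The substitution [x -> n - 1 - x] preserves signs because [n - 1] is even. *)
Lemma alt_sum_rev G n : odd n ->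
  alt_sum (fun y => G (-1 - y)) n = alt_sum (fun y => G (y - n%:Z)) n.
Proof.
move=> n_odd; rewrite /alt_sum (reindex_inj rev_ord_inj) /=.
apply: eq_bigr => i _; rewrite subnS -subn1 -subnDA addn1 -subzn// opprB.
congr (_ * G _); last by rewrite -[(i.+1)]add1n PoszD; ring.
by rewrite -signr_odd oddB// n_odd /= negbK signr_odd.
Qed.

Lemma alt_sum_succ G n : odd n ->
  alt_sum (fun y => G (y + 1)) n = G 0 + G n - alt_sum G n.
Proof.
move=> n_odd.
(* Induction needs every [m]; the sign of [G m] becomes [+] only for odd [m]. *)
have h m : alt_sum (fun y => G (y + 1)) m = G 0 - (-1) ^+ m * G m - alt_sum G m.
  rewrite /alt_sum; elim: m => [|m IH].
    by rewrite !big_ord0 mul1r !subrr.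
  by rewrite !big_ord_recr /= IH exprS -[m.+1]addn1 PoszD; ring.
by rewrite h -signr_odd n_odd expr1 mulN1r opprK.
Qed.

(* The sum over [x < p^N * j] is a signed sum of translates by multiples of
   p^N; as the signs add up to 1 for odd j, it is close to the sum over
   [x < p^N]. *)
Lemma alt_sum_pX_mul G N e j : 0 < e ->
  (forall y a : int, pabs (G (y + p%:Z ^+ N * a) - G y) < e) -> odd j ->
  pabs (alt_sum G (p ^ N * j) - alt_sum G (p ^ N)) < e.
Proof.
move=> e0 h j_odd; suff H m :
    pabs (alt_sum G (p ^ N * m) - (odd m)%:R * alt_sum G (p ^ N)) < e.
  by have := H j; rewrite j_odd mul1r.
elim: m => [|m IH]; first by rewrite muln0 /alt_sum big_ord0 mul0r subr0 pabs0.
rewrite mulnS addnC alt_sum_addn -signr_odd oddM odd_pX /= signr_odd.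
set S := alt_sum G (p ^ N); set T := alt_sum _ (p ^ N).
have -> : alt_sum G (p ^ N * m) + (-1) ^+ m * T - (~~ odd m)%:R * S =
  (alt_sum G (p ^ N * m) - (odd m)%:R * S) + (-1) ^+ m * (T - S).
  by rewrite -signr_odd; case: (odd m) => /=; ring.
rewrite pabsD_lt// pabs_sign_mul alt_sum_lt// => x.
have -> : (p ^ N * m)%N = p%:Z ^+ N * m :> int.
  by rewrite PoszM -[p%:Z]natz -natrX natz.
exact: h.
Qed.

(** The cofactor [p^(N - N0)] is odd, so [alt_sum_pX_mul] makes the sums a Cauchy sequence in the
    complete field [K]. *)
Lemma alt_lim_ex G : padic_bucont G -> exists l, alt_lim G l.
Proof.
move=> cG.
pose u N := alt_sum G (p ^ N).
have u_close e : 0 < e ->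
    exists N0, forall N, (N0 <= N)%N -> pabs (u N - u N0) < e.
  move=> e0; have [N0 hN0] := bucont_le _ _ cG e0; exists N0 => N le.
  rewrite /u -{1}(subnKC le) expnD alt_sum_pX_mul ?odd_pX//.
  exact: hN0.
have : cauchy (u @ \oo).
  apply/cauchy_exP => e e0; have [N0 hN0] := u_close e e0.
  exists (u N0), N0 => // N /hN0.
  by rewrite /= ballEmdist /= mdist_pabs pabsC.
move=> /cauchy_cvgP/cvg_ex[l /cvg_ballP ul]; exists l => e e0.
have [N0 _ hN0] := ul e e0; exists N0 => N /hN0.
by rewrite ballEmdist /= mdist_pabs pabsC.
Qed.

Lemma alt_lim_ext G H l :
  (forall x : nat, G x = H x) -> alt_lim G l -> alt_lim H l.
Proof.
move=> GH h e /h[N0 hN0]; exists N0 => N /hN0.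
by congr (pabs (_ - _) < e); apply: eq_bigr => i _; rewrite GH.
Qed.

Lemma alt_lim0 : alt_lim (fun=> 0) 0.
Proof.
move=> e e0; exists 0%N => N _.
by rewrite /alt_sum big1 ?subr0 ?pabs0// => i _; rewrite mulr0.
Qed.

Lemma alt_limD G H l l' : alt_lim G l -> alt_lim H l' ->
  alt_lim (fun y => G y + H y) (l + l').
Proof.
move=> hG hH e e0; have [[N hN] [M hM]] := (hG e e0, hH e e0).
exists (maxn N M) => k; rewrite geq_max => /andP[Nk Mk].
have -> : alt_sum (fun y => G y + H y) (p ^ k) =
    alt_sum G (p ^ k) + alt_sum H (p ^ k).
  by rewrite -big_split; apply: eq_bigr => i _; rewrite mulrDr.
by rewrite opprD addrACA pabsD_lt ?hN ?hM.
Qed.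

Lemma alt_limZ c G l : alt_lim G l -> alt_lim (fun y => c * G y) (c * l).
Proof.
move=> h e e0; have c1 : 0 < pabs c + 1 by rewrite ltr_wpDl ?pabs_ge0.
have [N0 hN0] := h _ (divr_gt0 e0 c1); exists N0 => N /hN0.
have -> : alt_sum (fun y => c * G y) (p ^ N) = c * alt_sum G (p ^ N).
  by rewrite /alt_sum mulr_sumr; apply: eq_bigr => i _; rewrite mulrCA.
rewrite -mulrBr pabsM (ltr_pdivlMr _ _ c1) => ?.
by have := pabs_ge0 (alt_sum G (p ^ N) - l); nra.
Qed.

Lemma alt_lim_sum (I : Type) (r : seq I) (F : I -> int -> K) (l : I -> K) :
  (forall i, alt_lim (F i) (l i)) ->
  alt_lim (fun y => \sum_(i <- r) F i y) (\sum_(i <- r) l i).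
Proof.
move=> h; elim: r => [|i r IH].
  by rewrite big_nil; apply: alt_lim_ext alt_lim0 => y; rewrite big_nil.
rewrite big_cons; apply: alt_lim_ext (alt_limD _ _ _ _ (h i) IH) => y.
by rewrite big_cons.
Qed.

(** The limit of [alt_sum_succ], as [G (p^N)] tends to [G 0]. *)
Lemma alt_lim_succ G l : padic_bucont G -> alt_lim G l ->
  alt_lim (fun y => G (y + 1)) (2%:R * G 0 - l).
Proof.
move=> cG h e e0; have [[N hN] [M hM]] := (bucont_le _ _ cG e0, h e e0).
exists (maxn N M) => k; rewrite geq_max => /andP[Nk Mk].
rewrite alt_sum_succ ?odd_pX//.
have -> : G 0 + G (p ^ k)%N - alt_sum G (p ^ k) - (2%:R * G 0 - l) =
    (G (p ^ k)%N - G 0) - (alt_sum G (p ^ k) - l) by ring.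
rewrite pabsB_lt ?hM//; have := hN k Nk 0 1.
by rewrite add0r mulr1 -[p%:Z]natz -natrX natz.
Qed.

(** After reversal only a translation by [-p^N] remains, negligible by uniform continuity. *)
Lemma alt_lim_rev G l : padic_bucont G -> alt_lim G l ->
  alt_lim (fun y => G (-1 - y)) l.
Proof.
move=> cG h e e0; have [[N hN] [M hM]] := (bucont_le _ _ cG e0, h e e0).
exists (maxn N M) => k; rewrite geq_max => /andP[Nk Mk].
rewrite alt_sum_rev ?odd_pX// -(subrK (alt_sum G (p ^ k)) (alt_sum _ _)) -addrA.
rewrite pabsD_lt ?hM// alt_sum_lt// => x.
by have := hN k Nk x (-1); rewrite mulrN1 -[p%:Z]natz -natrX natz.
Qed.

(* [1 - y = (-1 - y) + 2], and each unit shift costs a boundary term. *)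
Lemma alt_lim_refl G l : padic_bucont G -> alt_lim G l ->
  alt_lim (fun y => G (1 - y)) (l + 2%:R * (G 1 - G 0)).
Proof.
move=> cG h.
have cG1 : padic_bucont (fun y => G (y + 1)).
  by have := bucont_affine _ 1 1 cG; under eq_fun do rewrite mul1r.
have cG2 : padic_bucont (fun y => G (y + 2)).
  by have := bucont_affine _ 1 2 cG; under eq_fun do rewrite mul1r.
have := alt_lim_succ _ _ cG1 (alt_lim_succ _ _ cG h).
rewrite add0r opprB addrCA -mulrBr => h2.
apply: (alt_lim_ext (fun y => G (-1 - y + 2))).
  by move=> x; congr (G _); ring.
apply: (alt_lim_rev (fun y => G (y + 2))) => //.
by apply: alt_lim_ext h2 => x; rewrite -addrA.
Qed.

End AlternatingLimit.

(** * Powers at integer exponents and reduction of the integral to alternating limits *)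

Section PadicInterpolation.
Context {p : nat} {R : realType} {K : padicComplexType p R}.
Implicit Types (Q l : K) (G : int -> K).
Hypotheses (p_prime : prime p) (p_odd : odd p).

Lemma padicInt_val_int (a : int) : padicInt_val (a%:~R : padicInt K) = a%:~R.
Proof. exact: (rmorph_int (val : padicInt K -> K)). Qed.

Lemma nat_near_ball (x : padicInt K) (A : set nat) : nat_near x A <->
  exists2 e : R, 0 < e & forall n, pabs (padicInt_val x - n%:R) < e -> A n.
Proof.
split.
  move=> [U /nbhs_ballP[e /= e0 eU] UA]; exists e => // n hn.
  by apply: UA; apply: eU; rewrite ballEmdist /= mdist_pabs.
move=> [e e0 h]; exists (ball (padicInt_val x) e); first exact: nbhsx_ballx.
by move=> n /=; rewrite ballEmdist /= mdist_pabs; exact: h.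
Qed.

(** Makes the limit in [zpow] meaningful at integers, negative ones included: each is a p-adic limit
    of natural numbers. *)
Lemma nat_near_int_proper (a : int) :
  ProperFilter (nat_near (a%:~R : padicInt K)).
Proof.
apply: filter_from_proper.
  apply: filter_from_filter; first by exists setT; exact: filterT.
  by move=> A B hA hB; exists (A `&` B) => //; exact: filterI.
move=> U /nbhs_ballP[e /= e0 eU].
have [|N hN] := exists_expr_lt R p%:R^-1 e _ e0.
  by rewrite invr_ge0 ler0n invf_lt1 ?ltr0n ?ltr1n ?prime_gt1// prime_gt0.
(* Adding [p^N |a|] makes [a] nonnegative and moves it by at most [p^(-N)]. *)
pose m : int := a + p%:Z ^+ N * `|a|%N.
have m0 : 0 <= m.
  have : 1 <= p%:Z ^+ N.
    by rewrite -[p%:Z]natz -natrX natz lez_nat expn_gt0 prime_gt0.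
  move=> P1; rewrite /m abszE -[a]opprK addrC subr_ge0 opprK.
  by rewrite (le_trans (ler_norm _))// normrN ler_peMl.
exists `|m|%N; apply: eU; rewrite padicInt_val_int ballEmdist /= mdist_pabs pabsC.
have -> : (`|m|%N%:R : K) = m%:~R by rewrite -{2}(gez0_abs m0).
rewrite /m intrD addrC addKr intrM pabsM rmorphXn /= pabs_pX.
by rewrite (le_lt_trans _ hN)// ler_piMr ?pabs_int// exprn_ge0// invr_ge0.
Qed.

(** The sums defining the integrals use [zpow] only at integers. A natural number close to [a] is
    congruent to it modulo [p^N], so [bucont_exprz] applies. *)
Lemma zpow_int Q (a : int) : zpow_base Q -> zpow Q a%:~R = Q ^ a.
Proof.
move=> bQ; have FF := nat_near_int_proper a.
apply: cvg_lim; first exact: metric_hausdorff.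
apply/cvg_ballP => e e0; apply/nat_near_ball.
have [N hN] := bucont_le _ _ (bucont_exprz Q bQ) e0.
have p0 : 0 < p%:R^-1 ^+ N :> R by rewrite exprn_gt0// invr_gt0 ltr0n prime_gt0.
exists (p%:R^-1 ^+ N) => // n.
rewrite padicInt_val_int ballEmdist /= mdist_pabs => hn.
have [|b ab] := pabs_int_dvd (K := K) p_prime (a - n%:Z) N.
  by rewrite intrB ltW.
have -> : a = n%:Z + p%:Z ^+ N * b by rewrite -ab addrC subrK.
exact: (hN N (leqnn N) n b).
Qed.

Lemma zpow_base_Tp (z : K) : Tp z -> zpow_base z.
Proof.
move=> [n n1 zn]; have pz : pabs z = 1.
  apply/eqP; rewrite -(@pexpr_eq1 _ _ (p ^ n)) ?expn_gt0 ?prime_gt0 ?pabs_ge0//.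
  by rewrite -pabsX zn pabs1.
by apply: zpow_baseP => // e e0; exists n; rewrite zn subrr pabs0.
Qed.

Lemma pabs_2 : pabs (2%:R : K) = 1.
Proof.
apply: (pabs_int_coprime p_prime 2); apply/negP => /dvdn_leq /=.
by move/(_ isT); case: (p) p_prime p_odd => [|[|[|?]]].
Qed.

(** [G] absorbs the weight [Q^x], and the normalisation tends to [(1 + Q) / 2] since [Q^(p^N)] tends
    to 1. *)
Lemma fermionic_integralE Q (f : padicInt K -> K) G l : pabs (Q - 1) < 1 ->
  (forall x : nat, f x%:R * Q ^+ x = G x) -> alt_lim G l ->
  fermionic_integral Q f = (1 + Q) / 2%:R * l.
Proof.
move=> Q1 fG Gl; have bQ := zpow_base_near1 p_prime Q Q1; have [pQ hQ] := bQ.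
have SE N : \sum_(x < p ^ N) f x%:R * (- Q) ^+ x = alt_sum G (p ^ N).
  apply: eq_bigr => i _.
  by rewrite -fG [(- Q) ^+ _]exprNn mulrCA.
rewrite /fermionic_integral; under eq_fun do rewrite SE.
apply: cvg_lim; first exact: metric_hausdorff.
apply/cvg_ballP => e e0.
have l1 : 0 < pabs l + 1 by rewrite ltr_wpDl ?pabs_ge0.
have [[N hN] [M hM]] := (Gl e e0, hQ _ (divr_gt0 e0 l1)).
near=> k; have Nk : (N <= k)%N by near: k; exact: nbhs_infty_ge.
have Mk : (M <= k)%N by near: k; exact: nbhs_infty_ge.
rewrite ballEmdist /= mdist_pabs pabsC.
have := hN k Nk; have := hM k Mk.
set S := alt_sum _ _; set q := Q ^+ _ => hq hS.
(* Otherwise [2 = (1 + q) - (q - 1)] would have absolute value below 1, impossible for odd [p]. *)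
have q1 : pabs (1 + q) = 1.
  have q1 : pabs (q - 1) < 1 by apply: le_lt_trans Q1; rewrite pabs_subX1 ?pQ.
  apply/eqP; rewrite eq_le (le_trans (pabsD_max _ _)) /=.
    2: by rewrite ge_max pabs1 (pabs_near1 _ q1) lexx.
  rewrite leNgt; apply/negP => /pabsB_lt/(_ q1).
  have -> : 1 + q - (q - 1) = 2%:R by ring.
  by rewrite pabs_2 ltxx.
have q0 : 1 + q != 0 by rewrite -pabs_eq0 q1 oner_eq0.
have n2 : 2%:R != 0 :> K by rewrite -pabs_eq0 pabs_2 oner_eq0.
(* The error splits into that of the sum and that of [q] against 1; the prefactor has absolute value
   at most 1. *)
have -> : (1 + Q) / (1 + q) * S - (1 + Q) / 2%:R * l =
   (1 + Q) / (2%:R * (1 + q)) * (2%:R * (S - l) - (q - 1) * l).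
  by field; apply/andP.
rewrite pabsM [X in X * _](_ : _ = pabs (1 + Q)); last first.
  by rewrite pabsM pabsV pabsM pabs_2 q1 mulr1 invr1 mulr1.
apply: le_lt_trans (ler_piMl (pabs_ge0 _) _) _.
  by rewrite (le_trans (pabsD_max _ _))// ge_max pabs1 pQ lexx.
rewrite pabsB_lt// pabsM ?pabs_2 ?mul1r//.
move: hq; rewrite (ltr_pdivlMr _ _ l1) => ?.
by have := pabs_ge0 (q - 1); nra.
Unshelve. all: by end_near. Qed.

End PadicInterpolation.

(** * Binomial identities *)

(** With [y] in the role of [[1 - x]_{1/q}], the powers of [1 - y] collect into [(1 - y)^(s k)],
    which is then expanded. *)
Lemma bernstein_prod (A : comNzRingType) (s k : nat) (n : 'I_s -> nat) (y : A) :
  \prod_i ('C(n i, k)%:R * (1 - y) ^+ k * y ^+ (n i - k)) =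
  (\prod_i 'C(n i, k)%:R) *
  \sum_(l < (s * k).+1) 'C(s * k, l)%:R * (-1) ^+ (l + s * k)
    * y ^+ ((\sum_i n i) - l).
Proof.
(* If some [n i < k], a zero binomial coefficient kills both sides; otherwise every [n i - k] is a
   true difference. *)
have [/existsP[i ik]|] := boolP [exists i, (n i < k)%N].
  by rewrite (bigD1 i)//= [X in _ = X * _](bigD1 i)//= bin_small// !mul0r.
move=> /existsPn kn; rewrite !big_split /= -mulrA; congr (_ * _).
rewrite prodr_const card_ord -exprM mulnC prodrXr.
have kN : (s * k <= \sum_i n i)%N.
  by rewrite -{1}(card_ord s) -sum_nat_const leq_sum// => i _; rewrite leqNgt.
have -> : (\sum_i (n i - k) = \sum_i n i - s * k)%N.
  rewrite sumnB => [|i _]; last by rewrite leqNgt.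
  by rewrite sum_nat_const card_ord.
rewrite addrC exprDn mulr_suml; apply: eq_bigr => l _.
rewrite expr1n mulr1 [(- y) ^+ _]exprNn -mulr_natl -!mulrA -exprD.
congr (_ * (_ * _ ^+ _)).
  (* [s k - l] and [l + s k] have the same parity. *)
  by rewrite -signr_odd oddB ?leq_ord// -oddD addnC signr_odd.
by rewrite addnC addnBA ?leq_ord// subnK.
Qed.

(** The expansion of [(1 - 1)^m]; its exception [m = 0] is the source of the separate case
    [k = 0]. *)
Lemma alternating_binomial_sum (A : comNzRingType) (m : nat) :
  \sum_(l < m.+1) 'C(m, l)%:R * (-1) ^+ (l + m) = (m == 0)%:R :> A.
Proof.
transitivity ((1 - 1 : A) ^+ m); last by rewrite subrr expr0n.
rewrite addrC exprDn; apply: eq_bigr => l _.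
rewrite expr1n mulr1 mulr_natl; congr (_ *+ _).
by rewrite -signr_odd oddD addbC -oddB ?leq_ord// signr_odd.
Qed.

(** * q-numbers at integer arguments *)

Section QNumbers.
Context {p : nat} {R : realType} {K : padicComplexType p R}.
Implicit Types (Q : K) (a : int).
Hypotheses (p_prime : prime p) (p_odd : odd p).

Definition qint Q a : K := if Q == 1 then a%:~R else (1 - Q ^ a) / (1 - Q).

Lemma qnum_int Q a : pabs (Q - 1) < 1 -> qnum Q (a%:~R : padicInt K) = qint Q a.
Proof.
move=> Q1; rewrite /qnum /qint padicInt_val_int zpow_int//.
exact: zpow_base_near1.
Qed.

Lemma qint0 Q : qint Q 0 = 0.
Proof. by rewrite /qint expr0z subrr mul0r; case: ifP. Qed.

Lemma qint1 Q : qint Q 1 = 1.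
Proof.
rewrite /qint expr1z; case: eqVneq => // Q1.
by rewrite divff// subr_eq0 eq_sym.
Qed.

Lemma qint2 Q : qint Q 2 = 1 + Q.
Proof.
rewrite /qint; case: eqVneq => [->//|Q1].
have Q0 : 1 - Q != 0 by rewrite subr_eq0 eq_sym.
by rewrite -exprnP; field.
Qed.

(** For [Q] other than 1, [[1 - a]_{1/Q} = (Q^a - Q) / (1 - Q)]. This makes each Bernstein factor a
    polynomial in [[1 - x]_{1/q}] alone. *)
Lemma qint_refl Q a : Q != 0 -> qint Q a = 1 - qint Q^-1 (1 - a).
Proof.
move=> Q0; rewrite /qint invr_eq1; case: eqVneq => [_|Q1].
  by rewrite intrB opprB addrC subrK.
have Q1' : 1 - Q != 0 by rewrite subr_eq0 eq_sym.
have Q1'' : Q - 1 != 0 by rewrite subr_eq0.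
rewrite exprz_inv opprB expfzDr// exprN1.
by field; apply/and3P.
Qed.

Lemma bucont_qint Q : pabs (Q - 1) < 1 -> padic_bucont (qint Q).
Proof.
move=> Q1; rewrite /qint; case: (Q == 1); first exact: bucont_intr.
apply: bucontM; last exact: bucont_cst.
by apply: bucontB; [exact: bucont_cst|apply/bucont_exprz/zpow_base_near1].
Qed.

End QNumbers.

(** * Reflection of the integrals defining the q-Euler numbers *)

Section Reflection.
Context {p : nat} {R : realType} {K : padicComplexType p R}.
Hypotheses (p_prime : prime p) (p_odd : odd p).
Variables (q zeta : K) (h : int).
Hypotheses (hq : pabs (q - 1) < 1) (hzeta : Tp zeta).

(** The exponent is [h * y], not [(h - 1) * y]: the weight [q^(-y)] of the measure is included. *)
Definition qEuler_integrand (m : nat) (y : int) : K :=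
  qint q^-1 y ^+ m * zeta^-1 ^ y * q^-1 ^ (h * y).

Let bq := zpow_base_near1 p_prime q hq.
Let bz := zpow_base_Tp p_prime zeta hzeta.
Let q0 : q != 0 := zpow_base_neq0 q bq.
Let z0 : zeta != 0 := zpow_base_neq0 zeta bz.

Lemma pabs_qV_near1 : pabs (q^-1 - 1) < 1.
Proof. by rewrite pabs_subV1// pabs_near1. Qed.

Lemma bucont_qEuler_integrand m : padic_bucont (qEuler_integrand m).
Proof.
apply: bucontM; first apply: bucontM.
- by apply/bucontX/bucont_qint/pabs_qV_near1.
- exact/bucont_exprz/zpow_baseV.
- have := bucont_affine _ h 0 (bucont_exprz _ (zpow_baseV _ bq)).
  by under eq_fun do rewrite addr0.
Qed.

Lemma mulr_intr_nat (c : int) (x : nat) :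
  c%:~R * x%:R = (c * x%:Z)%:~R :> padicInt K.
Proof. by rewrite intrM. Qed.

Lemma qEulerE m L : alt_lim (qEuler_integrand m) L ->
  qEuler h m q^-1 zeta^-1 = (1 + q^-1) / 2%:R * L.
Proof.
move=> hL.
apply: (fermionic_integralE p_prime p_odd _ _ _ _ pabs_qV_near1 _ hL).
move=> x; rewrite add0r mulr_intr_nat [x%:R](_ : _ = x%:Z%:~R)//.
rewrite qnum_int ?pabs_qV_near1// !zpow_int//; try exact: zpow_baseV.
rewrite /qEuler_integrand -!mulrA; congr (_ * (_ * _)).
by rewrite exprnP -expfzDr ?invr_eq0// mulrBl mul1r subrK.
Qed.

(** At [y = 1 - x], [zeta^(-y) q^(-h y)] is [zeta^(x - 1) q^(h x - h)]; the constant restores the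
    missing powers. *)
Lemma qEuler_integrand_refl m (x : int) :
  qint q^-1 (1 - x) ^+ m * q ^ (h * x) * zeta ^ x =
  q ^ h * zeta * qEuler_integrand m (1 - x).
Proof.
rewrite /qEuler_integrand !exprz_inv mulrBr mulr1 !opprB !expfzDr// exprN1.
rewrite -invr_expz; have qh0 : q ^ h != 0 by rewrite expfz_neq0.
by field; apply/andP.
Qed.

Lemma alt_lim_qEuler_refl m L : (0 < m)%N -> alt_lim (qEuler_integrand m) L ->
  alt_lim (fun x => qint q^-1 (1 - x) ^+ m * q ^ (h * x) * zeta ^ x)
    (q ^ h * zeta * L + 2%:R).
Proof.
move=> m0 hL.
have := alt_limZ (q ^ h * zeta) _ _
  (alt_lim_refl p_odd _ _ (bucont_qEuler_integrand m) hL).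
under eq_fun do rewrite -qEuler_integrand_refl.
(* The integrand vanishes at 0 because [m > 0] and is [zeta^(-1) q^(-h)] at 1, so the boundary term
   is exactly 2. *)
rewrite /qEuler_integrand qint1 qint0 expr0n gtn_eqF// !mul0r subr0.
rewrite expr1n mulr1 mul1r expr1z exprz_inv -invr_expz.
have qh0 : q ^ h != 0 by rewrite expfz_neq0.
by congr (alt_lim _ _); field; apply/andP.
Qed.

(** Linearity is applied to alternating limits, so a whole binomial expansion is integrated at
    once. *)
Lemma fermionic_integral_refl (c : K) (I : Type) (r : seq I) (d : I -> K)
    (m : I -> nat) (f : padicInt K -> K) :
  (forall i, (0 < m i)%N) ->
  (forall x : nat, f x%:R =
     c * (\sum_(i <- r) d i * qnum q^-1 (1 - x%:R) ^+ m i)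
     * zpow q ((h - 1)%:~R * x%:R) * zpow zeta x%:R) ->
  fermionic_integral q f =
  c * \sum_(i <- r)
    d i * (q ^ (h + 1) * zeta * qEuler h (m i) q^-1 zeta^-1 + (1 + q)).
Proof.
move=> m0 hf.
have /choice[L hL] j : exists l, alt_lim (qEuler_integrand j) l.
  exact/alt_lim_ex/bucont_qEuler_integrand.
have lim_sum := alt_limZ c _ _ (alt_lim_sum _ r _ _ (fun i =>
  alt_limZ (d i) _ _ (alt_lim_qEuler_refl _ _ (m0 i) (hL (m i))))).
rewrite (fermionic_integralE p_prime p_odd _ _ _ _ hq _ lim_sum) => [|x].
  rewrite mulrCA; congr (c * _); rewrite mulr_sumr; apply: eq_bigr => i _.
  (* As [1 + q = q (1 + q^-1)], passing to the normalisation at [q^-1] raises [q^h] to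
     [q^(h + 1)]. *)
  rewrite (qEulerE _ _ (hL (m i))) expfzDr// expr1z.
  by field; rewrite q0 -pabs_eq0 pabs_2 ?oner_eq0.
rewrite hf mulr_intr_nat [x%:R](_ : _ = x%:Z%:~R)// -[1 - _](intrB _ 1).
rewrite qnum_int ?pabs_qV_near1// !zpow_int//.
rewrite -!mulrA; congr (c * _); rewrite mulr_suml; apply: eq_bigr => i _.
rewrite -!mulrA; congr (_ * (_ * _)); rewrite mulrCA mulrC exprnP.
congr (_ * _).
by rewrite -expfzDr// mulrBl mul1r subrK.
Qed.

End Reflection.

Theorem theorem10 (R : realType) (p : nat) (p_prime : prime p) (p_odd : odd p)
    (K : padicComplexType p R) (q : K) (hq : pabs (q - 1) < 1) (h : int)
    (zeta : K) (hzeta : Tp zeta) (s : nat) (hs : (2 <= s)%N)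
    (n : 'I_s -> nat) (k : nat) (hn : (s * k < \sum_i n i)%N) :
  fermionic_integral q
    (fun x : padicInt K => (\prod_i qBernstein k (n i) x q)
                     * zpow q ((h - 1)%:~R * x) * zpow zeta x)
  = if k == 0%N then
      q ^ (h + 1) * zeta * qEuler h (\sum_i n i)%N q^-1 zeta^-1 + qnum q 2%:R
    else
      q ^ (h + 1) * zeta * (\prod_i 'C(n i, k)%:R)
      * \sum_(l < (s * k).+1)
          'C(s * k, l)%:R * (-1) ^+ (l + s * k)
          * qEuler h ((\sum_i n i) - l)%N q^-1 zeta^-1.
Proof.
have q0 : q != 0 := zpow_base_neq0 q (zpow_base_near1 p_prime q hq).
have qV1 : pabs (q^-1 - 1) < 1 := pabs_qV_near1 q hq.
(* Since [l <= s k], [hn] keeps every exponent positive, as the reflection formula requires. *)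
have m_gt0 (l : 'I_(s * k).+1) : (0 < \sum_i n i - l)%N.
  by rewrite subn_gt0 (leq_trans (ltn_ord l)).
rewrite (fermionic_integral_refl p_prime p_odd _ _ h hq hzeta
  (\prod_i 'C(n i, k)%:R) _ (index_enum _)
  (fun l : 'I_(s * k).+1 => 'C(s * k, l)%:R * (-1) ^+ (l + s * k)) _ _ m_gt0)
  => [|x].
  rewrite [X in _ * X](eq_bigr _ (fun l _ => mulrDr _ _ _)).
  (* The constants [1 + q] are gathered with total coefficient [(1 - 1)^(s k)]. *)
  rewrite big_split /= -mulr_suml alternating_binomial_sum.
  have [->|k0] := eqVneq k 0%N.
    (* Only [l = 0] occurs and all binomial coefficients are 1, so one [[2]_q] survives. *)
    rewrite muln0 eqxx big_ord1 [\prod_i _]big1 => [|i _]; last by rewrite bin0.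
    by rewrite (qnum_int p_prime q 2 hq) qint2 /= bin0 expr0 subn0 !mul1r.
  (* Here [s k] is nonzero, so the constants cancel. *)
  rewrite muln_eq0 (negPf k0) gtn_eqF ?(ltnW hs)//= mul0r addr0.
  rewrite [RHS]mulrAC mulrC; congr (_ * _); rewrite mulr_sumr.
  by apply: eq_bigr => l _; rewrite mulrCA.
congr (_ * _ * _); rewrite -bernstein_prod; apply: eq_bigr => i _.
congr (_ * _ ^+ _ * _); rewrite [x%:R](_ : _ = x%:Z%:~R)// -[1 - _](intrB _ 1).
by rewrite !qnum_int// qint_refl.
Qed.
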